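(* Let $V$ be the $9$-dimensional $\mathbb F_3$-vector space with basis $e_1,\ldots,e_9$, let $q:V\to\Lambda^2V$ be the linear map given explicitly in the context, and let $A=V^*$ be equipped with the bilinear anticommutative product defined by \[ \langle \alpha\cdot\beta,v\rangle=\langle \alpha\wedge\beta,q(v)\rangle\qquad(\alpha,\beta\in V^*,\ v\in V). \] Then a subspace $U\leq V$ satisfies $q(U)\subseteq\Lambda^2U$ if and only if $U^\perp=\{\alpha\in V^*:\alpha(U)=0\}$ is an ideal of the algebra $A$. Consequently, the statement ''the only subspaces $U\leq V$ with $q(U)\subseteq\Lambda^2U$ are $0$ and $V$'' is equivalent to simplicity of $A$.
   Context: The pairing of $\Lambda^2V^*$ with $\Lambda^2V$ is the standard one, $\langle\alpha\wedge\beta,u\wedge w\rangle=\alpha(u)\beta(w)-\alpha(w)\beta(u)$. An ideal of $A$ is a subspace $J$ with $\alpha\cdot\beta\in J$ for all $\alpha\in J$, $\beta\in A$. Simplicity of $A$ means that $A$ has no nonzero proper ideals. The linear map $q:V\to\Lambda^2V$ is defined on the basis by \begin{align*} q(e_1)&=e_2\wedge e_3+e_4\wedge e_5+e_6\wedge e_7+e_8\wedge e_9,\\ q(e_2)&=e_1\wedge e_3+e_4\wedge e_6+e_5\wedge e_8+e_7\wedge e_9,\\ q(e_3)&=e_1\wedge e_2+e_4\wedge e_7+e_5\wedge e_9+e_6\wedge e_8,\\ q(e_4)&=e_1\wedge e_5+e_2\wedge e_6+e_3\wedge e_9+e_7\wedge e_8,\\ q(e_5)&=e_1\wedge e_4+e_2\wedge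 e_8+e_3\wedge e_7+e_6\wedge e_9,\\ q(e_6)&=e_1\wedge e_7+e_2\wedge e_9+e_3\wedge e_5+e_4\wedge e_8,\\ q(e_7)&=e_1\wedge e_8+e_4\wedge e_9+e_3\wedge e_6+e_2\wedge e_5,\\ q(e_8)&=e_1\wedge e_9+e_3\wedge e_4+e_2\wedge e_7+e_5\wedge e_6,\\ q(e_9)&=e_1\wedge e_6+e_3\wedge e_8+e_2\wedge e_4+e_5\wedge e_7. \end{align*} *)

(* Defs.v *)
From HB Require Import structures.
From mathcomp Require Import all_boot all_order all_algebra ring.

Set Implicit Arguments.
Unset Strict Implicit.
Unset Printing Implicit Defensive.

Import GRing.Theory.
Local Open Scope ring_scope.

Notation dual V := 'Hom(V, _^o) (only parsing).

(* The exterior square of V is realised as the vector space with basis the    *)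
(* b_i /\ b_j for i < j, where b := vbasis fullv; the coordinates of u /\ w   *)
(* are the 2 x 2 minors of the coordinates of (u, w). The universal property  *)
(* (wedge_bilinear, wedge_alternating, ext2_liftE and ext2_hom_ext below)     *)
(* shows that this does not depend on the choice of b.                        *)

Notation lt_pair n := {p : 'I_n * 'I_n | (p.1 < p.2)%N}.

Notation ext2 V := {ffun lt_pair (\dim {:V}) -> _^o} (only parsing).

Section ExteriorSquare.
Variables (K : fieldType) (V : vectType K).

Local Notation b := (vbasis {:V}).
Local Notation L2 := {ffun lt_pair (\dim {:V}) -> K^o}.

Definition wedge (u w : V) : L2 :=
  [ffun p => coord b (val p).1 u * coord b (val p).2 w
             - coord b (val p).2 u * coord b (val p).1 w].

Definition ext2_lift (W : vectType K) (f : V -> V -> W) (t : L2) : W :=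
  \sum_p t p *: f b`_(val p).1 b`_(val p).2.

Fact ext2_lift_linear (W : vectType K) (f : V -> V -> W) : linear (ext2_lift f).
Proof.
move=> a s t; rewrite /ext2_lift scaler_sumr -big_split /=.
by apply: eq_bigr => p _; rewrite !ffunE scalerDl scalerA.
Qed.

HB.instance Definition _ (W : vectType K) (f : V -> V -> W) :=
  GRing.isLinear.Build K L2 W *:%R (ext2_lift f) (ext2_lift_linear f).

Lemma wedge_bilinear : bilinear_for *:%R *:%R wedge.
Proof.
have scE (x : K) (y : K^o) : x *: y = x * y :> K by [].
by split=> [w|u] a x y; apply/ffunP=> p; rewrite !ffunE !linearP /= !scE; ring.
Qed.

Lemma wedge_alternating (u : V) : wedge u u = 0.
Proof. by apply/ffunP=> p; rewrite !ffunE mulrC subrr. Qed.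

Lemma wedge_basis (p : lt_pair (\dim {:V})) :
  wedge b`_(val p).1 b`_(val p).2 = [ffun r => (r == p)%:R].
Proof.
have bfree : free b := basis_free (vbasisP _).
apply/ffunP=> r; rewrite ffunE [in RHS]ffunE !coord_free // -!natrM !mulnb.
have -> : (r == p) = ((val p).1 == (val r).1) && ((val p).2 == (val r).2).
  by rewrite -val_eqE -pair_eqE /= !(eq_sym (val r).1) !(eq_sym (val r).2).
case: ((val p).1 =P (val r).2) => [e1|_]; last by rewrite subr0.
case: ((val p).2 =P (val r).1) => [e2|_]; last by rewrite subr0.
by have := ltnW (valP r); rewrite -e1 -e2 leqNgt (valP p).
Qed.

Lemma ext2_liftE (W : vectType K) (f : V -> V -> W) :
    bilinear_for *:%R *:%R f -> (forall u, f u u = 0) ->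
  forall u w, ext2_lift f (wedge u w) = f u w.
Proof.
move=> [fl fr] falt u w; pose n := \dim {:V}.
have fN x y : f x y = - f y x.
  have fDl x1 x2 z : f (x1 + x2) z = f x1 z + f x2 z.
    by have := fl z 1 x1 x2; rewrite /= !scale1r.
  have fDr x1 x2 z : f z (x1 + x2) = f z x1 + f z x2.
    by have := fr z 1 x1 x2; rewrite /= !scale1r.
  apply/eqP; rewrite -addr_eq0; have := falt (x + y).
  by rewrite fDl !fDr !falt add0r addr0 => ->.
pose fL z := GRing.isLinear.Build _ _ _ _ _ (fl z).
pose fR z := GRing.isLinear.Build _ _ _ _ _ (fr z).
pose gl z : {linear V -> W} := HB.pack (f^~ z) (fL z).
pose gr z : {linear V -> W} := HB.pack (f z) (fR z).
pose G (p : 'I_n * 'I_n) := (coord b p.1 u * coord b p.2 w) *: f b`_p.1 b`_p.2.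
have -> : f u w = \sum_p G p.
  rewrite -(pair_bigA _ (fun i j => G (i, j))) /= {1}(coord_vbasis (memvf u)).
  rewrite -[f _ w]/(gl w _) linear_sum; apply: eq_bigr => i _.
  rewrite linearZ /= {1}(coord_vbasis (memvf w)) -[f _ _]/(gr b`_i _) linear_sum.
  by rewrite scaler_sumr; apply: eq_bigr => j _; rewrite linearZ scalerA.
rewrite (bigID (fun p : 'I_n * 'I_n => (p.1 < p.2)%N)) /=.
rewrite [X in _ = _ + X](bigID (fun p : 'I_n * 'I_n => (p.2 < p.1)%N)) /=.
rewrite [X in _ + (_ + X)]big1 ?addr0 => [|[i j] /= /andP[]]; last first.
  rewrite -!leqNgt => leji leij; have <- : i = j by apply/val_inj/anti_leq/andP.
  by rewrite /G falt scaler0.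
rewrite [X in _ = _ + X](eq_bigl (fun p : 'I_n * 'I_n => (p.2 < p.1)%N));
  last by move=> p; rewrite -leqNgt andb_idl // => /ltnW.
rewrite [X in _ = _ + X](reindex_inj (can_inj (@swap_pairK 'I_n 'I_n))) /=.
rewrite -big_split /= /ext2_lift.
rewrite (reindex_omap (val : lt_pair n -> 'I_n * 'I_n) insub) /= => [|p ltp];
  last by rewrite insubT.
apply: eq_big => [p|[[i j] ltij] _]; first by rewrite (valP p) valK eqxx.
by rewrite ffunE /G /= [f b`_j _]fN scalerN scalerBl.
Qed.

Lemma ext2_hom_ext (W : vectType K) (g h : {linear L2 -> W}) :
  (forall u w, g (wedge u w) = h (wedge u w)) -> g =1 h.
Proof.
move=> gh t.
have -> : t = \sum_p t p *: wedge b`_(val p).1 b`_(val p).2.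
  apply/ffunP=> r; rewrite sum_ffunE (bigD1 r) //= big1 => [|p neq].
    by rewrite wedge_basis !ffunE eqxx addr0 /GRing.scale /= mulr1.
  by rewrite wedge_basis !ffunE eq_sym (negPf neq) scaler0.
by rewrite !linear_sum; apply: eq_bigr => p _; rewrite !linearZ /= gh.
Qed.

(* The canonical image of the exterior square of U in that of V. *)
Definition ext2v (U : {vspace V}) : {vspace L2} :=
  <<[seq wedge u w | u <- vbasis U, w <- vbasis U]>>%VS.

Lemma ext2v_sub (U : {vspace V}) (T : {vspace L2}) :
  (ext2v U <= T)%VS <-> {in U &, forall u w, wedge u w \in T}.
Proof.
split=> [/span_subvP sUT u w Uu Uw | sUT]; last first.
  apply/span_subvP=> _ /allpairsP[[u w] /= [Uu Uw ->]].
  by apply: sUT; apply: vbasis_mem.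
have [wl wr] := wedge_bilinear.
pose fL z := GRing.isLinear.Build _ _ _ _ _ (wl z).
pose fR z := GRing.isLinear.Build _ _ _ _ _ (wr z).
pose gl z : {linear V -> L2} := HB.pack (@wedge^~ z) (fL z).
pose gr z : {linear V -> L2} := HB.pack (@wedge z) (fR z).
rewrite (coord_vbasis Uu) -[wedge _ w]/(gl w _) linear_sum.
apply: memv_suml => i _; rewrite linearZ memvZ //= (coord_vbasis Uw).
rewrite -[wedge _ _]/(gr _ _) linear_sum.
apply: memv_suml => j _; rewrite linearZ memvZ //=.
by apply/sUT/allpairs_f; apply: mem_nth; rewrite size_tuple.
Qed.

Definition ann (U : {vspace V}) : {vspace dual V} :=
  (\bigcap_(i < \dim U)
     lker (linfun (fun alpha : dual V => alpha (vbasis U)`_i : K^o)))%VS.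

Lemma annP (U : {vspace V}) (alpha : dual V) :
  reflect {in U, forall u, alpha u = 0} (alpha \in ann U).
Proof.
have evE (u : V) (a : dual V) : linfun (fun a : dual V => a u : K^o) a = a u.
  have ev_lin : linear (fun a : dual V => a u : K^o).
    by move=> c x y; rewrite !lfunE /= lfunE.
  pose fL := GRing.isLinear.Build _ _ _ _ _ ev_lin.
  pose g : {linear dual V -> K^o} := HB.pack (fun a : dual V => a u : K^o) fL.
  exact: (lfunE g).
rewrite /ann memvE; apply: (iffP subv_bigcapP) => [aU u Uu | aU i _].
  rewrite (coord_vbasis Uu) linear_sum big1 // => i _; rewrite linearZ /=.
  by have := aU i isT; rewrite -memvE memv_ker evE => /eqP ->; rewrite scaler0.
rewrite -memvE memv_ker evE; apply/eqP/aU.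
by apply: vbasis_mem; apply: mem_nth; rewrite size_tuple.
Qed.

End ExteriorSquare.

Section Pairing.
Variables (K : fieldType) (V : vectType K).

(* The linear extension, in each argument, of                                 *)
(* <alpha /\ beta, u /\ w> = alpha(u) beta(w) - alpha(w) beta(u).             *)
Definition ext2_pairing (s : ext2 (dual V)) (t : ext2 V) : K :=
  ext2_lift (fun alpha beta : dual V =>
    ext2_lift (fun u w : V => alpha u * beta w - alpha w * beta u : K^o) t) s.

Lemma ext2_pairing_bilinear :
  bilinear_for *:%R *:%R (ext2_pairing : _ -> _ -> K^o).
Proof.
split=> [t|s] a x y; first exact: linearP.
pose b := vbasis {:dual V}.
have liftE (W : vectType K) (g : dual V -> dual V -> W) :
  ext2_lift g s = \sum_p s p *: g b`_(val p).1 b`_(val p).2 by [].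
rewrite /= /ext2_pairing !liftE scaler_sumr -big_split /=.
by apply: eq_bigr => p _; rewrite ext2_lift_linear scalerDr !scalerA mulrC.
Qed.

Lemma ext2_pairingE (alpha beta : dual V) (u w : V) :
  ext2_pairing (wedge alpha beta) (wedge u w)
  = alpha u * beta w - alpha w * beta u.
Proof.
have scE (x : K) (y : K^o) : x *: y = x * y :> K by [].
pose f (a c : dual V) (x y : V) : K^o := a x * c y - a y * c x.
have fE (a c : dual V) x y : ext2_lift (f a c) (wedge x y) = f a c x y.
  apply: ext2_liftE => {x y} [|x]; last by rewrite /f mulrC subrr.
  by split=> [z|z] k x y; rewrite /f !linearP /= !scE; ring.
rewrite /ext2_pairing.
rewrite (ext2_liftE (f := fun a c => ext2_lift (f a c) (wedge u w))).
- exact: fE.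
- by split=> [c|c] k x y; rewrite !fE /f !lfunE /= !lfunE /= !scE; ring.
- by move=> a; rewrite fE /f mulrC subrr.
Qed.

End Pairing.

Section Product.
Variables (K : fieldType) (V : vectType K) (q : 'Hom(V, ext2 V)).

Definition ext2_prod (alpha beta : dual V) : dual V :=
  linfun (fun v => ext2_pairing (wedge alpha beta) (q v) : K^o).

Lemma ext2_prodE (alpha beta : dual V) (v : V) :
  ext2_prod alpha beta v = ext2_pairing (wedge alpha beta) (q v).
Proof.
have lin : linear (fun v => ext2_pairing (wedge alpha beta) (q v) : K^o).
  move=> k x y; rewrite linearP.
  exact: (ext2_pairing_bilinear V).2.
pose fL := GRing.isLinear.Build _ _ _ _ _ lin.
pose g : {linear V -> K^o} :=
  HB.pack (fun v => ext2_pairing (wedge alpha beta) (q v) : K^o) fL.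
exact: (lfunE g).
Qed.

Lemma ext2_prod_bilinear : bilinear_for *:%R *:%R ext2_prod.
Proof.
have [pl _] := ext2_pairing_bilinear V.
have [wl wr] := wedge_bilinear (dual V).
split=> [c|c] k x y; apply/lfunP=> v; rewrite !lfunE /= !lfunE /= !ext2_prodE.
  by rewrite wl; apply: pl.
by rewrite wr; apply: pl.
Qed.

Lemma ext2_prod_alternating (alpha : dual V) : ext2_prod alpha alpha = 0.
Proof.
apply/lfunP=> v; rewrite ext2_prodE wedge_alternating lfunE /=.
by rewrite /ext2_pairing linear0.
Qed.

Lemma ext2_prod_anticommutative (alpha beta : dual V) :
  ext2_prod alpha beta = - ext2_prod beta alpha.
Proof.
have wN : wedge alpha beta = - wedge beta alpha.
  by apply/ffunP=> p; rewrite !ffunE opprB mulrC [X in _ - X]mulrC.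
apply/lfunP=> v; rewrite opp_lfunE !ext2_prodE wN.
by rewrite /ext2_pairing linearN.
Qed.

End Product.

Section Ideals.
Variables (K : fieldType) (A : vectType K) (mul : A -> A -> A).

Definition is_ideal (J : {vspace A}) :=
  forall alpha beta, alpha \in J -> mul alpha beta \in J.

Definition is_simple := forall J, is_ideal J -> J = 0%VS \/ J = fullv.

End Ideals.

Section QMap.
Variables (V : vectType 'F_3) (e : 9.-tuple V).

(* w is 1-based: w i j is e_i /\ e_j with e_1 := e`_0, ..., e_9 := e`_8. *)
Definition q_table : seq (ext2 V) :=
  let w i j := wedge e`_i.-1 e`_j.-1 in
  [:: w 2 3 + w 4 5 + w 6 7 + w 8 9;
      w 1 3 + w 4 6 + w 5 8 + w 7 9;
      w 1 2 + w 4 7 + w 5 9 + w 6 8;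
      w 1 5 + w 2 6 + w 3 9 + w 7 8;
      w 1 4 + w 2 8 + w 3 7 + w 6 9;
      w 1 7 + w 2 9 + w 3 5 + w 4 8;
      w 1 8 + w 4 9 + w 3 6 + w 2 5;
      w 1 9 + w 3 4 + w 2 7 + w 5 6;
      w 1 6 + w 3 8 + w 2 4 + w 5 7].

Definition q_map : 'Hom(V, ext2 V) :=
  linfun (fun v => \sum_(i < 9) coord e i v *: q_table`_i).

Lemma q_map_basis (i : 'I_9) : basis_of fullv e -> q_map e`_i = q_table`_i.
Proof.
move=> /basis_free efree.
have lin : linear (fun v => \sum_(i < 9) coord e i v *: q_table`_i).
  move=> k x y; rewrite scaler_sumr -big_split /=.
  by apply: eq_bigr => j _; rewrite linearP /= scalerDl scalerA.
pose fL := GRing.isLinear.Build _ _ _ _ _ lin.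
pose g : {linear V -> ext2 V} :=
  HB.pack (fun v => \sum_(i < 9) coord e i v *: q_table`_i) fL.
rewrite -[q_map]/(linfun g) lfunE /= (bigD1 i) //= coord_free // eqxx scale1r.
rewrite big1 ?addr0 // => j ji.
by rewrite coord_free // eq_sym (negPf ji) scale0r.
Qed.

End QMap.

(* Main.v *)
From HB Require Import structures.
Require Import Defs.
From mathcomp Require Import all_boot all_order all_algebra.
From mathcomp Require Import ring.

Import GRing.Theory.
Local Open Scope ring_scope.

(** Both equivalences are instances of duality in finite-dimensional linear
    algebra, for an arbitrary linear map q from V to its exterior square.

    The first equivalence is a duality for exterior squares: a bivector t lies
    in the exterior square of U exactly when it pairs to 0 with alpha /\ beta
    for all alpha in ann U and all beta ([mem_ext2vP]). Taking t = q u with u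
    in U, and unfolding the product through its pairing, the right-hand side
    says that alpha * beta kills U, that is, lies in ann U. To see the duality,
    let P be the projection of V onto U. The bivector obtained from t by
    applying P to both factors always lies in the exterior square of U, and
    its coordinates differ from those of t by pairings of t with forms having
    a factor c - c o P, which vanishes on U ([wedge_map_sub_coord]).

    The second equivalence follows because U |-> ann U is a bijection between
    the subspaces of V and those of its dual ([ann_inj], [ann_surj])
    that exchanges 0 with the whole space. *)

(** * Annihilators *)

Section Annihilators.
Variables (K : fieldType) (V : vectType K).
Implicit Types (U : {vspace V}) (J : {vspace dual V}).

Local Notation b := (vbasis {:V}).

Lemma lfun_coordE (i : 'I_(\dim {:V})) (v : V) :
  (linfun (coord b i : V -> K^o)) v = coord b i v.
Proof. exact: (lfunE (coord b i : {linear V -> K^o})). Qed.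

(** The projection fixes U pointwise. These forms supply enough elements of
    [ann U] to cut out both U and its exterior square. *)
Lemma sub_comp_projv_ann U (alpha : dual V) :
  alpha - (alpha \o projv U)%VF \in ann U.
Proof.
apply/annP=> u Uu; rewrite add_lfunE opp_lfunE comp_lfunE.
by rewrite projv_id // subrr.
Qed.

Lemma mem_ann_separates U (u : V) :
  (forall alpha : dual V, alpha \in ann U -> alpha u = 0) -> u \in U.
Proof.
move=> annu; suff -> : u = projv U u by apply: memv_proj.
rewrite [LHS](coord_vbasis (memvf u)) [RHS](coord_vbasis (memvf (projv U u))).
apply: eq_bigr => i _; congr (_ *: _); apply/eqP; rewrite -subr_eq0 -!lfun_coordE.
have := annu _ (sub_comp_projv_ann U (linfun (coord b i : V -> K^o))).
by rewrite add_lfunE opp_lfunE comp_lfunE => ->.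
Qed.

Lemma ann_inj : injective (@ann K V).
Proof.
move=> U1 U2 eqU.
by apply/eqP; rewrite eqEsubv; apply/andP; split; apply/subvP=> u Uu;
  apply: mem_ann_separates => a; [rewrite -eqU | rewrite eqU] => /annP->.
Qed.

Lemma ann0 : ann (0%VS : {vspace V}) = fullv.
Proof.
apply/eqP; rewrite eqEsubv subvf; apply/subvP=> a _.
by apply/annP=> u; rewrite memv0 => /eqP->; rewrite linear0.
Qed.

Lemma annf : ann (fullv : {vspace V}) = 0%VS.
Proof.
apply/eqP; rewrite -subv0; apply/subvP=> a /annP a0; rewrite memv0.
by apply/eqP/lfunP=> u; rewrite a0 ?memvf // lfunE.
Qed.

(** If the common kernel of a_1, ..., a_n is contained in the kernel of phi,
    then phi factors through F := (a_1, ..., a_n) : V -> K^n, and is therefore a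
    linear combination of the a_i. Applied to a basis of J, this shows that J
    is the annihilator of its common kernel. *)
Lemma ann_surj J : exists U, ann U = J.
Proof.
pose a i : dual V := (vbasis J)`_i.
have Flin : linear (fun v => \row_(i < \dim J) (a i v : K)).
  by move=> k x y; apply/rowP=> i; rewrite !mxE linearP.
pose fL := GRing.isLinear.Build _ _ _ _ _ Flin.
pose g : {linear V -> 'rV[K]_(\dim J)} := HB.pack (fun v => \row_i a i v) fL.
pose F := linfun g.
have FE v i : F v 0 i = a i v by rewrite lfunE mxE.
exists (lker F); apply/eqP; rewrite eqEsubv; apply/andP; split; last first.
  apply/subvP=> phi Jphi; apply/annP=> v; rewrite memv_ker => /eqP Fv0.
  rewrite (coord_vbasis Jphi) sum_lfunE big1 // => i _.
  by rewrite lfunE /= -FE Fv0 mxE scaler0.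
apply/subvP=> phi /annP phi0.
(* F need not be onto: F^-1 is a right inverse of F only over its image. *)
have phiF v : phi v = phi (F^-1 (F v))%VF.
  apply/eqP; rewrite -subr_eq0 -linearB; apply/eqP/phi0.
  rewrite memv_ker linearB /=.
  by rewrite limg_lfunVK ?subrr ?memv_img ?memvf.
have -> : phi = \sum_(i < \dim J) phi ((F^-1)%VF (delta_mx 0 i)) *: a i.
  apply/lfunP=> v; rewrite phiF (row_sum_delta (F v)) !linear_sum sum_lfunE.
  by apply: eq_bigr => i _; rewrite !linearZ scale_lfunE FE [LHS]mulrC.
by apply: memv_suml => i _; rewrite memvZ // vbasis_mem // mem_nth ?size_tuple.
Qed.

End Annihilators.

(** * Duality for exterior squares *)

Section Duality.
Variables (K : fieldType) (V : vectType K).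
Implicit Type U : {vspace V}.

Local Notation b := (vbasis {:V}).

Lemma ext2_pairing_linear (s : ext2 (dual V)) :
  linear (ext2_pairing s : ext2 V -> K^o).
Proof. exact: (ext2_pairing_bilinear V).2. Qed.

HB.instance Definition _ (s : ext2 (dual V)) :=
  GRing.isLinear.Build K (ext2 V) K^o *:%R (ext2_pairing s)
    (ext2_pairing_linear s).

Definition wedge_map (f : 'End(V)) : ext2 V -> ext2 V :=
  ext2_lift (fun u w => wedge (f u) (f w)).

HB.instance Definition _ (f : 'End(V)) := GRing.Linear.on (wedge_map f).

Lemma wedge_mapE (f : 'End(V)) u w :
  wedge_map f (wedge u w) = wedge (f u) (f w).
Proof.
have [wl wr] := wedge_bilinear V.
rewrite /wedge_map ext2_liftE // => [|x]; last exact: wedge_alternating.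
by split=> [z|z] k x y; rewrite linearP; [apply: wl | apply: wr].
Qed.

(** This is c /\ d - cf /\ df = (c - cf) /\ d - (d - df) /\ cf, evaluated at t,
    where c and d are coordinate forms and cf, df their composites with f. *)
Lemma wedge_map_sub_coord (f : 'End(V)) (t : ext2 V) p :
  let c i : dual V := linfun (coord b i : V -> K^o) in
  let cf i := (c i \o f)%VF in
  let i := (val p).1 in let j := (val p).2 in
  t p - wedge_map f t p = ext2_pairing (wedge (c i - cf i) (c j)) t
                          - ext2_pairing (wedge (c j - cf j) (cf i)) t.
Proof.
move=> c cf i j.
pose gl (t : ext2 V) : K^o := t p - wedge_map f t p.
pose gr (t : ext2 V) : K^o :=
  ext2_pairing (wedge (c i - cf i) (c j)) t
  - ext2_pairing (wedge (c j - cf j) (cf i)) t.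
have scE (x : K) (y : K^o) : x *: y = x * y :> K by [].
have gl_lin : linear gl.
  by move=> k x y; rewrite /gl linearP !ffunE /= !scE; ring.
have gr_lin : linear gr.
  by move=> k x y; rewrite /gr !linearP /= !scE; ring.
pose gL := GRing.isLinear.Build _ _ _ _ _ gl_lin.
pose gR := GRing.isLinear.Build _ _ _ _ _ gr_lin.
pose hl : {linear ext2 V -> K^o} := HB.pack gl gL.
pose hr : {linear ext2 V -> K^o} := HB.pack gr gR.
apply: (@ext2_hom_ext K V K^o hl hr) => u w.
rewrite /hl /hr /= /gl /gr wedge_mapE !ext2_pairingE !ffunE.
have cE k v : c k v = coord b k v by exact: lfun_coordE.
have cfE k v : cf k v = coord b k (f v) by rewrite /cf comp_lfunE cE.
have dE k v : (c k - cf k) v = coord b k v - coord b k (f v).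
  by rewrite add_lfunE opp_lfunE cE cfE.
by rewrite !dE !cE !cfE -/i -/j; ring.
Qed.

Lemma mem_ext2vP U (t : ext2 V) :
  t \in ext2v U <->
  forall alpha beta : dual V, alpha \in ann U ->
    ext2_pairing (wedge alpha beta) t = 0.
Proof.
split=> [Ut alpha beta /annP aU | orth].
  pose k := lker (linfun (ext2_pairing (wedge alpha beta) : ext2 V -> K^o)).
  have /subvP sUk : (ext2v U <= k)%VS.
    apply/ext2v_sub=> u w Uu Uw; rewrite memv_ker lfunE /=.
    by rewrite ext2_pairingE !aU // !mul0r subrr.
  by have := sUk _ Ut; rewrite memv_ker lfunE => /eqP.
have -> : t = wedge_map (projv U) t.
  apply/ffunP=> p; apply/eqP; rewrite -subr_eq0 wedge_map_sub_coord.
  by rewrite !orth ?subrr // sub_comp_projv_ann.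
apply: memv_suml => p _; apply: memvZ.
by have /ext2v_sub := subvv (ext2v U); apply; apply: memv_proj.
Qed.

End Duality.

(** * Ideals and simplicity *)

Section IdealsAndSimplicity.
Variables (K : fieldType) (V : vectType K) (q : 'Hom(V, ext2 V)).

Lemma sub_ext2v_ideal (U : {vspace V}) :
  (q @: U <= ext2v U)%VS <-> is_ideal (ext2_prod q) (ann U).
Proof.
split=> [/subvP qU alpha beta aU | idealU].
  apply/annP=> u Uu; rewrite ext2_prodE.
  have /mem_ext2vP orth : q u \in ext2v U by apply/qU/memv_img.
  exact: orth.
apply/subvP=> _ /memv_imgP[u Uu ->]; apply/mem_ext2vP=> alpha beta aU.
by rewrite -ext2_prodE; apply: (annP _ _ (idealU alpha beta aU)).
Qed.

Lemma invariant_trivial_simple :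
  (forall U : {vspace V}, (q @: U <= ext2v U)%VS -> U = 0%VS \/ U = fullv) <->
  is_simple (ext2_prod q).
Proof.
split=> [triv J | simpleA U /sub_ext2v_ideal /simpleA].
  have [U <-] := ann_surj _ _ J => /sub_ext2v_ideal /triv.
  by case=> ->; [right; apply: ann0 | left; apply: annf].
by rewrite -ann0 -annf => -[] /ann_inj; [right | left].
Qed.

End IdealsAndSimplicity.

Theorem proposition6p1
    (V : vectType 'F_3) (e : 9.-tuple V) (basis_e : basis_of fullv e) :
  (forall U : {vspace V},
     (q_map e @: U <= ext2v U)%VS <-> is_ideal (ext2_prod (q_map e)) (ann U)) /\
  ((forall U : {vspace V},
      (q_map e @: U <= ext2v U)%VS -> U = 0%VS \/ U = fullv) <->
   is_simple (ext2_prod (q_map e))).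
Proof.
by split; [apply: sub_ext2v_ideal | apply: invariant_trivial_simple].
Qed.
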